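(* Assume the (possibly nonconvex) loss $f(\cdot,z)$ is $\beta$-smooth for all $z\in\mathcal{Z}$. Consider full-batch gradient descent with $T$ iterations and learning rates $\eta_t$, $t\le T+1$. Then for the outputs $W_{T+1}\equiv A(S)$ and $W^{(i)}_{T+1}\equiv A(S^{(i)})$, $$\epsilon_{\mathrm{stab}(A)}\le\frac{4\,\epsilon_{\mathrm{path}}}{n^2}\sum_{t=1}^T\eta_t\prod_{j=t+1}^T(1+\beta\eta_j)^2 .$$
   Context: Let $\mathcal{D}$ be a distribution on $\mathcal{Z}$ and $z_1,\dots,z_n,z_i'$ i.i.d. from $\mathcal{D}$; $S=(z_1,\dots,z_n)$, $S^{(i)}$ is $S$ with $z_i$ replaced by $z_i'$. The loss $f:\mathbb{R}^d\times\mathcal{Z}\to[0,\infty)$ is non-negative; $\beta$-smooth means $\|\nabla f(w,z)-\nabla f(u,z)\|_2\le\beta\|w-u\|_2$ for all $w,u$. Full-batch gradient descent (GD) on $S$: from a fixed initial point $W_1\in\mathbb{R}^d$, $W_{t+1}=W_t-\frac{\eta_t}{n}\sum_{j=1}^n\nabla f(W_t,z_j)$, $t=1,\dots,T$, with output $A(S)=W_{T+1}$; $W^{(i)}_t$ are the GD iterates on $S^{(i)}$ with the same initial point $W^{(i)}_1=W_1$ and the same step sizes. Expected output stability $\epsilon_{\mathrm{stab}(A)}=\mathbb{E}[\|A(S)-A(S^{(i)})\|_2^2]$; expected path error $\epsilon_{\mathrm{path}}=\sum_{t=1}^T\eta_t\,\mathbb{E}[\|\nabla f(W_t,z_i)\|_2^2]$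 (expectations over all samples). *)

(* Defs.v *)
From HB Require Import structures.
From mathcomp Require Import all_boot all_order all_algebra.
From mathcomp Require Import all_classical all_reals all_analysis.
Set Implicit Arguments. Unset Strict Implicit. Unset Printing Implicit Defensive.
Import Order.TTheory GRing.Theory Num.Theory.
Import numFieldNormedType.Exports.
Local Open Scope classical_set_scope.
Local Open Scope ring_scope.

(* Euclidean (l2) norm on R^d, represented as row vectors 'rV[R]_d.
   (The library norm on 'rV is the sup norm, hence this explicit definition.) *)
Definition norm2 {R : realType} {d : nat} (v : 'rV[R]_d) : R :=
  Num.sqrt (\sum_(k < d) v ord0 k ^+ 2).

Definition grad {R : realType} {d : nat} (h : 'rV[R]_d -> R) (w : 'rV[R]_d)
  : 'rV[R]_d := \row_(k < d) ('D_(delta_mx ord0 k) h w).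

Definition smooth {R : realType} {d : nat} {Z : Type}
  (f : 'rV[R]_d -> Z -> R) (beta : R) : Prop :=
  (forall z w, differentiable (fun u => f u z) w) /\
  (forall z w u, norm2 (grad (fun x => f x z) w - grad (fun x => f x z) u)
                  <= beta * norm2 (w - u)).

(* Full-batch GD on the sample S : 'I_n -> Z, with step sizes eta (indexed
   from 1) and initial point W1:  gd k = W_{k+1}, i.e.
   W_{t+1} = W_t - eta_t / n * sum_j grad f(W_t, z_j).  Output A(S) = gd T. *)
Fixpoint gd {R : realType} {d n : nat} {Z : Type} (f : 'rV[R]_d -> Z -> R)
  (eta : nat -> R) (W1 : 'rV[R]_d) (S : 'I_n -> Z) (k : nat) : 'rV[R]_d :=
  match k with
  | 0 => W1
  | k'.+1 =>
      let w := gd f eta W1 S k' in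
      w - (eta k'.+1 / n%:R) *: \sum_(j < n) grad (fun x => f x (S j)) w
  end.

Definition replace_at {n : nat} {Z : Type} (S : 'I_n -> Z) (i : 'I_n) (z' : Z)
  : 'I_n -> Z := fun j => if j == i then z' else S j.

(* Mutual independence of a finite family of random variables X k : Omega -> T
   (product rule for all families of measurable sets; taking some B k = setT
   gives the product rule for every subfamily). *)
Definition mutually_independent {d dT : measure_display} {Omega : measurableType d}
  {T : measurableType dT} {R : realType} {I : finType}
  (P : probability Omega R) (X : I -> Omega -> T) : Prop :=
  forall B : I -> set T, (forall k, measurable (B k)) ->
    P (\bigcap_(k in [set: I]) (X k @^-1` B k)) =
    \big[*%E/1%E]_(k : I) P (X k @^-1` B k).

Definition has_distribution {d dT : measure_display} {Omega : measurableType d}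
  {T : measurableType dT} {R : realType}
  (P : probability Omega R) (X : Omega -> T) (D : probability T R) : Prop :=
  measurable_fun setT X /\ forall B, measurable B -> P (X @^-1` B) = D B.

(* Main.v *)
Require Import Defs.
From HB Require Import structures.
From mathcomp Require Import all_boot all_order all_algebra.
From mathcomp Require Import ring lra.
From mathcomp Require Import all_classical all_reals all_analysis.
From mathcomp Require Import measurable_realfun.
Import Order.TTheory GRing.Theory Num.Theory.
Import numFieldNormedType.Exports.
Local Open Scope classical_set_scope.
Local Open Scope ring_scope.

(* With W_t and W'_t the iterates on S and S^(i), smoothness gives
   |W_(t+1) - W'_(t+1)| <= (1 + beta eta_t) |W_t - W'_t|
     + (eta_t / n) (|grad f(W_t, z_i)| + |grad f(W'_t, z_i')|).
   Unrolling, Cauchy-Schwarz with weights eta_t and (a + b)^2 <= 2 (a^2 + b^2)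
   bound |A(S) - A(S^(i))|^2 pathwise.  Since S and S^(i) have the same law,
   grad f(W'_t, z_i') is distributed as grad f(W_t, z_i), so both squared
   gradients contribute eps_path in expectation. *)

(** * Cauchy-Schwarz and the Euclidean norm *)

(** Induction on [s]: only the cross term of the new entry needs an argument. Used with unit weights
    for the triangle inequality and with the step sizes as weights for the stability bound. *)
Lemma weighted_cauchy_schwarz (R : realType) (I : Type) (s : seq I)
    (c x y : I -> R) : (forall k, 0 <= c k) ->
  (\sum_(k <- s) c k * (x k * y k)) ^+ 2 <=
  (\sum_(k <- s) c k * x k ^+ 2) * (\sum_(k <- s) c k * y k ^+ 2).
Proof.
move=> c0; elim: s => [|k s ih]; first by rewrite !big_nil mul0r expr0n.
have sq_ge0 (g : I -> R) : 0 <= \sum_(j <- s) c j * g j ^+ 2.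
  by apply: sumr_ge0 => j _; rewrite mulr_ge0 ?sqr_ge0.
rewrite !big_cons; move: ih (sq_ge0 x) (sq_ge0 y).
move: (\sum_(j <- s) c j * (x j * y j)) (\sum_(j <- s) c j * x j ^+ 2)
  (\sum_(j <- s) c j * y j ^+ 2) (c0 k) => A X Y ck ih X0 Y0.
(* AM-GM: the square of the right side is [(X * y k ^+ 2 - x k ^+ 2 * Y) ^+ 2] plus
   [4 * X * Y * (x k * y k) ^+ 2], and [A ^+ 2 <= X * Y] by induction. *)
have cross : 2 * (A * (x k * y k)) <= X * y k ^+ 2 + x k ^+ 2 * Y.
  apply: le_trans (ler_norm _) _.
  rewrite -(@ler_pXn2r _ 2) ?nnegrE//; last first.
    by rewrite addr_ge0// mulr_ge0// sqr_ge0.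
  rewrite real_normK ?num_real//.
  have := sqr_ge0 (X * y k ^+ 2 - x k ^+ 2 * Y).
  have : A ^+ 2 * (x k * y k) ^+ 2 <= X * Y * (x k * y k) ^+ 2.
    by rewrite ler_wpM2r ?sqr_ge0.
  by nra.
have := ler_wpM2l ck cross; nra.
Qed.

Section norm2.
Context {R : realType} {d : nat}.
Implicit Types u v w : 'rV[R]_d.

Lemma norm2_ge0 v : 0 <= norm2 v.
Proof. exact: sqrtr_ge0. Qed.

Lemma sqr_norm2 v : norm2 v ^+ 2 = \sum_(k < d) v ord0 k ^+ 2.
Proof. by rewrite sqr_sqrtr// sumr_ge0// => k _; rewrite sqr_ge0. Qed.

Lemma norm20 : norm2 (0 : 'rV[R]_d) = 0.
Proof.
by rewrite /norm2 big1 ?sqrtr0// => k _; rewrite mxE expr0n.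
Qed.

Lemma norm2Z (a : R) v : norm2 (a *: v) = `|a| * norm2 v.
Proof.
rewrite -sqrtr_sqr -sqrtrM ?sqr_ge0// mulr_sumr; congr Num.sqrt.
by apply: eq_bigr => k _; rewrite mxE exprMn.
Qed.

Lemma norm2N v : norm2 (- v) = norm2 v.
Proof. by rewrite -scaleN1r norm2Z normrN1 mul1r. Qed.

Lemma ler_norm2D u v : norm2 (u + v) <= norm2 u + norm2 v.
Proof.
have dot : \sum_(k < d) u ord0 k * v ord0 k <= norm2 u * norm2 v.
  apply: le_trans (ler_norm _) _.
  rewrite -(@ler_pXn2r _ 2) ?nnegrE ?mulr_ge0 ?norm2_ge0//.
  rewrite real_normK ?num_real// exprMn !sqr_norm2.
  have := @weighted_cauchy_schwarz R _ (index_enum 'I_d) (fun=> 1)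
    (u ord0) (v ord0) (fun=> ler01).
  under eq_bigr do rewrite mul1r.
  under [X in _ <= X * _ -> _]eq_bigr do rewrite mul1r.
  by under [X in _ <= _ * X -> _]eq_bigr do rewrite mul1r.
rewrite -(@ler_pXn2r _ 2) ?nnegrE ?addr_ge0 ?norm2_ge0//.
rewrite sqr_norm2 sqrrD !sqr_norm2.
under eq_bigr do rewrite mxE sqrrD.
by rewrite !big_split/= lerD2r lerD2l mulr2n lerD.
Qed.

Lemma ler_norm2B u v : norm2 (u - v) <= norm2 u + norm2 v.
Proof. by rewrite -(norm2N v) ler_norm2D. Qed.

Lemma ler_norm2_sum (I : Type) (s : seq I) (p : pred I) (F : I -> 'rV[R]_d) :
  norm2 (\sum_(k <- s | p k) F k) <= \sum_(k <- s | p k) norm2 (F k).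
Proof.
elim/big_ind2 : _ => [|x u y v xu yv|//]; first by rewrite norm20.
by apply: le_trans (ler_norm2D _ _) _; rewrite lerD.
Qed.

Lemma ler_coord_norm2 v k : `|v ord0 k| <= norm2 v.
Proof.
rewrite -sqrtr_sqr ler_wsqrtr// (bigD1 k)//= lerDl sumr_ge0// => j _.
exact: sqr_ge0.
Qed.

(** Together with [ler_coord_norm2], turns the Euclidean Lipschitz bound on the gradient into an l1
    bound for each of its coordinates, the form used for measurability. *)
Lemma ler_norm2_l1 v : norm2 v <= \sum_(k < d) `|v ord0 k|.
Proof.
have -> : v = \sum_(k < d) v ord0 k *: delta_mx ord0 k by exact: row_sum_delta.
apply: le_trans (ler_norm2_sum _ _ _ _) _.
rewrite -row_sum_delta ler_sum// => k _; rewrite norm2Z ler_piMr//.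
rewrite /norm2 (bigD1 k)//= big1 ?addr0 => [|j jk]; last first.
  by rewrite mxE (negbTE jk) andbF expr0n.
by rewrite mxE !eqxx expr1n sqrtr1.
Qed.

End norm2.

(** * Pathwise stability of gradient descent when one data point is replaced *)

(** The error [b t] injected at step [t] is amplified only by the later steps, hence the product
    from [t.+1]. *)
Lemma discrete_gronwall (R : realType) (delta a b : nat -> R) (m : nat) :
  (forall k, 0 <= a k) -> delta 0%N <= 0 ->
  (forall k, delta k.+1 <= a k.+1 * delta k + b k.+1) ->
  delta m <= \sum_(1 <= t < m.+1) b t * \prod_(t.+1 <= j < m.+1) a j.
Proof.
move=> a0 d0 step; elim: m => [|m ih]; first by rewrite big_geq.
rewrite big_nat_recr//= [\prod_(m.+2 <= _ < _) _]big_geq// mulr1.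
apply: le_trans (step m) _; rewrite lerD2r.
apply: le_trans (ler_wpM2l (a0 m.+1) ih) _.
rewrite mulr_sumr le_eqVlt; apply/orP; left; apply/eqP/eq_big_nat => t /andP[t1 tm].
by rewrite [in RHS]big_nat_recr//= mulrCA [a _ * _]mulrC.
Qed.

Section gd_replace.
Context {R : realType} {d n : nat} {Z : Type}.
Variables (f : 'rV[R]_d -> Z -> R) (beta : R) (eta : nat -> R) (W1 : 'rV[R]_d).
Hypothesis smooth_f : smooth f beta.
Hypothesis eta_ge0 : forall t, 0 <= eta t.
Variables (S : 'I_n -> Z) (i : 'I_n) (z : Z).

Let S' := replace_at S i z.
Let w k := gd f eta W1 S k.
Let w' k := gd f eta W1 S' k.
(** [g] and [g'] measure the gradients at the replaced data point, the one term of the sum that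
    smoothness cannot compare. Since [gd] counts from 0, [g t.-1] is the norm at the iterate W_t. *)
Let g k := norm2 (grad (f^~ (S i)) (w k)).
Let g' k := norm2 (grad (f^~ z) (w' k)).

Lemma gd_replace_step k : norm2 (w k.+1 - w' k.+1) <=
  (1 + beta * eta k.+1) * norm2 (w k - w' k) + eta k.+1 / n%:R * (g k + g' k).
Proof.
have n_gt0 : (0 < n%:R :> R) by rewrite ltr0n (leq_trans _ (ltn_ord i)).
have lip x := le_trans (norm2_ge0 _) (smooth_f.2 x (w k) (w' k)).
have -> : w k.+1 - w' k.+1 = (w k - w' k) - (eta k.+1 / n%:R) *:
    \sum_(j < n) (grad (f^~ (S j)) (w k) - grad (f^~ (S' j)) (w' k)).
  rewrite sumrB scalerBr /w /w' /= !opprB !addrA addrAC [RHS]addrAC.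
  by congr (_ + _); rewrite addrAC.
apply: le_trans (ler_norm2B _ _) _.
rewrite norm2Z ger0_norm ?divr_ge0 ?ler0n//.
have sum_le : norm2 (\sum_(j < n) (grad (f^~ (S j)) (w k) -
    grad (f^~ (S' j)) (w' k))) <= g k + g' k + n%:R * (beta * norm2 (w k - w' k)).
  rewrite (bigD1 i)//=; apply: le_trans (ler_norm2D _ _) _; apply: lerD.
    by rewrite /S' /replace_at eqxx; exact: ler_norm2B.
  apply: le_trans (ler_norm2_sum _ _ _ _) _.
  (* Only n - 1 terms remain; rounding up to n adds one more copy of the smoothness bound, which is
     nonnegative by [lip] whatever the sign of [beta]. *)
  rewrite -[n in n%:R]card_ord mulr_natl -sumr_const [leRHS](bigD1 i)//=.
  rewrite -[leLHS]add0r lerD//; first exact: lip z.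
  apply: ler_sum => j ji; rewrite /S' /replace_at (negbTE ji).
  exact: smooth_f.2.
apply: le_trans (lerD (lexx _) (ler_wpM2l _ sum_le)) _.
  by rewrite divr_ge0 ?ler0n.
by rewrite le_eqVlt; apply/orP; left; apply/eqP; field; rewrite lt0r_neq0.
Qed.

Lemma gd_replace_stability m : norm2 (w m - w' m) ^+ 2 <=
  2 / n%:R ^+ 2 *
  (\sum_(1 <= t < m.+1) eta t * \prod_(t.+1 <= j < m.+1) (1 + beta * eta j) ^+ 2) *
  \sum_(1 <= t < m.+1) eta t * (g t.-1 ^+ 2 + g' t.-1 ^+ 2).
Proof.
set K := \sum_(1 <= t < m.+1) _; set E := \sum_(1 <= t < m.+1) _.
have K0 : 0 <= K.
  apply: sumr_ge0 => t _; rewrite mulr_ge0// prodr_ge0// => j _.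
  exact: sqr_ge0.
have E0 : 0 <= E.
  by apply: sumr_ge0 => t _; rewrite mulr_ge0// addr_ge0// sqr_ge0.
(* Smoothness with a negative constant forces all norms to vanish. *)
have [beta0|beta0] := leP 0 beta; last first.
  have : 0 <= beta * norm2 (w m - w' m).
    exact: le_trans (norm2_ge0 _) (smooth_f.2 z _ _).
  rewrite nmulr_rge0// => le0.
  have -> : norm2 (w m - w' m) = 0 by apply/eqP; rewrite eq_le le0 norm2_ge0.
  by rewrite expr0n/= !mulr_ge0// invr_ge0 sqr_ge0.
have gronwall := @discrete_gronwall R (fun k => norm2 (w k - w' k))
  (fun j => 1 + beta * eta j) (fun t => eta t / n%:R * (g t.-1 + g' t.-1)) m.
have {}gronwall : norm2 (w m - w' m) <= n%:R^-1 * \sum_(1 <= t < m.+1)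
    eta t * ((g t.-1 + g' t.-1) * \prod_(t.+1 <= j < m.+1) (1 + beta * eta j)).
  rewrite mulr_sumr; apply: le_trans (gronwall _ _ _) _.
  - by move=> j; rewrite addr_ge0 ?mulr_ge0.
  - by rewrite subrr norm20.
  - exact: gd_replace_step.
  - by apply: ler_sum => t _; rewrite [eta t / _]mulrC -!mulrA.
apply: le_trans (lerXn2r 2 _ _ gronwall) _; rewrite ?nnegrE ?norm2_ge0//.
  exact: le_trans (norm2_ge0 _) gronwall.
rewrite exprMn exprVn.
(* Weights [eta t] against [g + g'] and the product: each of the two resulting sums keeps a single
   factor [eta t]. *)
apply: le_trans (ler_wpM2l _ (weighted_cauchy_schwarz _ _ _ _ _ _ _)) _ => //.
have -> : \sum_(1 <= t < m.+1) eta t *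
    (\prod_(t.+1 <= j < m.+1) (1 + beta * eta j)) ^+ 2 = K.
  by apply: eq_bigr => t _; rewrite prodrXl.
rewrite [2 / _]mulrC -!mulrA ler_wpM2l ?invr_ge0 ?sqr_ge0//.
rewrite [leLHS]mulrC [leRHS]mulrCA ler_wpM2l// mulr_sumr.
apply: ler_sum => t _; rewrite [leRHS]mulrCA ler_wpM2l//.
have := sqr_ge0 (g t.-1 - g' t.-1); nra.
Qed.

End gd_replace.

(** * Measurability of iterates and gradients *)

(** A Caratheodory-type result: the gradient is evaluated at a random iterate and a random data
    point at once, while measurability is given only for a fixed first argument. Rational vectors
    reduce the joint case to countably many fixed ones. *)
Lemma measurable_lipschitz_comp {dX dZ : measure_display}
    {X : measurableType dX} {Z : measurableType dZ} {R : realType} {m : nat}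
    (L : R) (G : 'rV[R]_m -> Z -> R) (V : X -> 'rV[R]_m) (zeta : X -> Z) :
  0 <= L -> (forall w, measurable_fun setT (G w)) ->
  (forall z w u, `|G w z - G u z| <= L * \sum_(k < m) `|w ord0 k - u ord0 k|) ->
  (forall k, measurable_fun setT (fun x => V x ord0 k)) ->
  measurable_fun setT zeta -> measurable_fun setT (fun x => G (V x) (zeta x)).
Proof.
move=> L0 mG lip mV mzeta mT.
apply: (measurability _ (RGenInftyO.measurableE R)) => // _ [_ [a ->] <-].
pose Q (q : 'rV[rat]_m) : 'rV[R]_m := map_mx ratr q.
pose dist x q := L * \sum_(k < m) `|V x ord0 k - Q q ord0 k|.
(* [G] being Lipschitz, [G v z] is the infimum of
   [G q z + L * sum_k `|v_k - q_k|] over rational [q]. *)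
have -> : setT `&` (fun x => G (V x) (zeta x)) @^-1` `]-oo, a[ =
    \bigcup_q ((fun x => G (Q q) (zeta x) + dist x q) @^-1` `]-oo, a[).
  rewrite setTI; apply/seteqP; split => x /=; rewrite in_itv/=; last first.
    case=> q _ /=; rewrite in_itv/=; apply: le_lt_trans.
    rewrite -lerBlDl; exact: le_trans (ler_norm _) (lip _ _ _).
  rewrite -subr_gt0; set e := a - _ => e0.
  (* The excess over [G (V x) (zeta x)] is at most [2 * L * m * eps], once from the Lipschitz bound
     and once from [dist]. The added ones keep the denominator positive when [L] or [m] is 0. *)
  pose eps := e / (2 * (L + 1) * m.+1%:R).
  have den0 : 0 < 2 * (L + 1) * m.+1%:R :> R.
    by rewrite mulr_gt0// mulr_gt0// ltr_wpDl.
  have eps0 : 0 < eps by rewrite divr_gt0.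
  have approx k : exists q : rat, `|V x ord0 k - ratr q| <= eps.
    have [q] : exists q : rat, ratr q \in `]V x ord0 k - eps, V x ord0 k + eps[.
      by apply: rat_in_itvoo; lra.
    by rewrite in_itv/= => /andP[? ?]; exists q; rewrite ler_norml; lra.
  have [q Vq] := choice approx.
  exists (\row_k q k) => //=; rewrite in_itv/=.
  have dist_le : dist x (\row_k q k) <= L * (m%:R * eps).
    rewrite ler_wpM2l// -[m in m%:R]card_ord mulr_natl -sumr_const.
    by apply: ler_sum => k _; rewrite !mxE.
  have small : 2 * (L * (m%:R * eps)) < e.
    have -> : e = 2 * ((L + 1) * (m.+1%:R * eps)).
      by rewrite /eps; field; rewrite nat1r !lt0r_neq0// ltr_wpDl.
    rewrite ltr_pM2l// -natr1.
    have : 0 <= L * eps by rewrite mulr_ge0// ltW.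
    have : 0 <= m%:R * eps by rewrite mulr_ge0// ltW.
    by nra.
  have := le_trans (ler_norm _) (lip (zeta x) (Q (\row_k q k)) (V x)).
  under eq_bigr do rewrite distrC.
  by rewrite -/(dist x _) /e in small *; lra.
apply: countable_bigcupT_measurable => // q.
rewrite -[X in measurable X]setTI.
suff : measurable_fun setT (fun x => G (Q q) (zeta x) + dist x q).
  by apply => //; exact: measurable_itv.
apply: measurable_funD; first exact: measurableT_comp.
apply: measurable_funM => //; apply: measurable_sum => k.
by apply: measurableT_comp => //; exact: measurable_funB.
Qed.

Section gd_measurable.
Context {dX dZ : measure_display} {X : measurableType dX} {Z : measurableType dZ}.
Context {R : realType} {d n : nat}.
Variables (f : 'rV[R]_d -> Z -> R) (beta : R) (eta : nat -> R) (W1 : 'rV[R]_d).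
Hypothesis smooth_f : smooth f beta.
Hypothesis mgrad : forall w k,
  measurable_fun setT (fun z => grad (fun x => f x z) w ord0 k).

Lemma measurable_grad_comp (V : X -> 'rV[R]_d) (zeta : X -> Z) k :
  (forall l, measurable_fun setT (fun x => V x ord0 l)) ->
  measurable_fun setT zeta ->
  measurable_fun setT (fun x => grad (f^~ (zeta x)) (V x) ord0 k).
Proof.
(* The absolute value provides a nonnegative Lipschitz constant. *)
apply: (@measurable_lipschitz_comp _ _ _ _ _ _ `|beta|
  (fun w z => grad (f^~ z) w ord0 k)) => // z w u.
have := ler_coord_norm2 (grad (f^~ z) w - grad (f^~ z) u) k.
rewrite !mxE => /le_trans; apply.
apply: le_trans (smooth_f.2 z w u) _.
apply: le_trans (ler_wpM2r (norm2_ge0 _) (ler_norm _)) _.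
rewrite ler_wpM2l//; apply: le_trans (ler_norm2_l1 _) _.
by apply: ler_sum => l _; rewrite !mxE.
Qed.

Lemma measurable_gd (S : X -> 'I_n -> Z) m :
  (forall j, measurable_fun setT (S^~ j)) ->
  forall k, measurable_fun setT (fun x => gd f eta W1 (S x) m ord0 k).
Proof.
move=> mS; elim: m => [|m ih] k /=; first exact: measurable_cst.
under eq_fun do rewrite !mxE summxE.
apply: measurable_funB => //; apply: measurable_funM => //.
apply: measurable_sum => j; exact: measurable_grad_comp.
Qed.

End gd_measurable.

Lemma measurable_sqr_norm2 {dX : measure_display} {X : measurableType dX}
    {R : realType} {m : nat} (V : X -> 'rV[R]_m) :
  (forall k, measurable_fun setT (fun x => V x ord0 k)) ->
  measurable_fun setT (fun x => norm2 (V x) ^+ 2).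
Proof.
move=> mV; under eq_fun do rewrite sqr_norm2.
by apply: measurable_sum => k; exact: measurable_funX.
Qed.

(** * Equality in law of the two samples *)

(** Rectangles, unlike single-coordinate cylinders, are closed under intersection, as the uniqueness
    theorem for measures requires of a generator. *)
Lemma tuple_measurableE {dZ : measure_display} (Z : measurableType dZ) (n : nat) :
  @measurable _ (n.-tuple Z) = <<s [set A | exists B : 'I_n -> set Z,
    (forall j, measurable (B j)) /\ A = [set t | forall j, B j (tnth t j)]] >>.
Proof.
apply/seteqP; split => A.
- apply: smallest_sub; first exact: smallest_sigma_algebra.
  rewrite -bigcup_seq => _ [j _ [Y mY <-]]; apply: sub_sigma_algebra.
  exists (fun l => if l == j then Y else setT); split.
    by move=> l; case: ifP.
  apply/seteqP; split => t /=; last by move=> /(_ j); rewrite eqxx.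
  by case=> _ Yt l; case: eqP => [->|].
- apply: smallest_sub; first exact: sigma_algebra_measurable.
  move=> _ [B [mB ->]].
  have -> : [set t : n.-tuple Z | forall j, B j (tnth t j)] =
      \bigcap_(j in [set: 'I_n]) ((@tnth n Z)^~ j @^-1` B j).
    by apply/seteqP; split => t Bt j; [move=> _|]; exact: (Bt j).
  apply: fin_bigcap_measurable => // j _.
  by rewrite -[X in measurable X]setTI; exact: measurable_tnth.
Qed.

Section iid_subfamily.
Context {dT dO : measure_display} {T : measurableType dT}
  {Omega : measurableType dO} {R : realType} {I : finType} {n : nat}.
Variables (P : probability Omega R) (D : probability T R) (X : I -> Omega -> T).
Hypothesis indep : mutually_independent P X.
Hypothesis distX : forall k, has_distribution P (X k) D.

Let Xtuple (h : 'I_n -> I) (omega : Omega) : n.-tuple T :=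
  [tuple X (h j) omega | j < n].

Lemma measurable_subfamily h : measurable_fun setT (Xtuple h).
Proof.
apply/measurable_fun_tnthP => j.
rewrite (_ : _ \o _ = X (h j)); first exact: (distX (h j)).1.
by apply/funext => omega /=; rewrite tnth_mktuple.
Qed.

(** Independence is a product rule over all of [I], so [B] is transported along [h] and completed by
    [setT] off its range, where the factors are 1. The value no longer depends on [h]. *)
Lemma prob_subfamily_rectangle (h : 'I_n -> I) (B : 'I_n -> set T) :
  injective h -> (forall j, measurable (B j)) ->
  P (Xtuple h @^-1` [set t | forall j, B j (tnth t j)]) =
  (\big[*%E/1%E]_(j < n) D (B j))%E.
Proof.
move=> h_inj mB.
pose C k := if [pick j | h j == k] is Some j then B j else setT.
have Ch j : C (h j) = B j.
  by rewrite /C; case: pickP => [l /eqP /h_inj ->//|/(_ j)]; rewrite eqxx.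
have mC k : measurable (C k) by rewrite /C; case: pickP.
have -> : Xtuple h @^-1` [set t | forall j, B j (tnth t j)] =
    \bigcap_(k in [set: I]) (X k @^-1` C k).
  apply/seteqP; split => omega /=.
    move=> BX k _; rewrite /C /=; case: pickP => [j /eqP <-|//].
    by have := BX j; rewrite tnth_mktuple.
  by move=> CX j; rewrite tnth_mktuple -Ch; exact: CX.
rewrite indep//; under eq_bigr => k _ do rewrite (distX k).2//.
rewrite (bigID (mem (h @: predT)))/= [X in (_ * X)%E]big1 ?mule1 => [|k kh].
  rewrite big_imset => [|j l _ _ /h_inj//].
  by apply: eq_big => j; rewrite ?inE// Ch.
rewrite /C; case: pickP => [j /eqP hj|_]; last exact: probability_setT.
by rewrite -hj imset_f in kh.
Qed.

(** The laws of the two tuples agree on rectangles, hence everywhere, and both integrals are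
    integrals of [phi] against this common law. *)
Lemma ge0_expectation_subfamily (h h' : 'I_n -> I) (phi : n.-tuple T -> \bar R) :
  injective h -> injective h' -> measurable_fun setT phi ->
  (forall t, 0 <= phi t)%E ->
  (\int[P]_omega phi (Xtuple h omega) = \int[P]_omega phi (Xtuple h' omega))%E.
Proof.
move=> h_inj h'_inj mphi phi0.
have mX := measurable_subfamily.
rewrite -[LHS](@ge0_integral_pushforward _ _ _ _ _ _ (mX h) P setT phi)//.
rewrite -[RHS](@ge0_integral_pushforward _ _ _ _ _ _ (mX h') P setT phi)//.
apply: eq_measure_integral => A mA _.
apply: (measure_unique _ (fun=> setT) (tuple_measurableE T n)) => //.
- move=> _ _ [B [mB ->]] [C [mC ->]]; exists (fun j => B j `&` C j); split.
    by move=> j; exact: measurableI.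
  apply/seteqP; split => t /=; first by case=> Bt Ct j; split.
  by move=> BCt; split => j; have [] := BCt j.
- by move=> k; exists (fun=> setT); split => //; apply/seteqP.
- by apply/seteqP; split => // t _; exists 0%N.
- move=> _ [B [mB ->]].
  exact: etrans (prob_subfamily_rectangle h B h_inj mB)
    (esym (prob_subfamily_rectangle h' B h'_inj mB)).
- by move=> k; rewrite /= /pushforward preimage_setT probability_setT ltry.
Qed.

End iid_subfamily.

(** * Integration of the pathwise bound *)

Theorem theorem7
  (R : realType) (d n : nat) (dZ dO : measure_display)
  (Z : measurableType dZ) (Omega : measurableType dO)
  (P : probability Omega R) (D : probability Z R)
  (zs : 'I_n -> Omega -> Z) (z' : Omega -> Z)
  (f : 'rV[R]_d -> Z -> R) (beta : R) (eta : nat -> R)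
  (W1 : 'rV[R]_d) (T : nat) (i : 'I_n) :
  (* z_1, ..., z_n, z_i' i.i.d. from D *)
  mutually_independent P (fun k : option 'I_n =>
      match k with Some j => zs j | None => z' end) ->
  (forall j, has_distribution P (zs j) D) ->
  has_distribution P z' D ->
  (* non-negative, beta-smooth loss *)
  (forall w z, 0 <= f w z) ->
  smooth f beta ->
  (* measurability of the gradient in the data point *)
  (forall w k, measurable_fun setT (fun z => grad (fun x => f x z) w ord0 k)) ->
  (* learning rates *)
  (forall t, 0 <= eta t) ->
  let S := fun omega => fun j => zs j omega in
  let Si := fun omega => replace_at (S omega) i (z' omega) in
  let W := fun omega t => gd f eta W1 (S omega) t.-1 in  (* W t = W_t, t >= 1 *)
  let eps_stab := (\int[P]_omega
        (norm2 (gd f eta W1 (S omega) T - gd f eta W1 (Si omega) T) ^+ 2)%:E)%E in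
  let eps_path := (\sum_(1 <= t < T.+1) (eta t)%:E *
        \int[P]_omega
          (norm2 (grad (fun x => f x (zs i omega)) (W omega t)) ^+ 2)%:E)%E in
  (eps_stab <= (4 / n%:R ^+ 2)%:E * eps_path *
     (\sum_(1 <= t < T.+1) eta t *
        \prod_(t.+1 <= j < T.+1) (1 + beta * eta j) ^+ 2)%:E)%E.
Proof.
move=> indep distS distz' _ smooth_f mgrad eta0.
pose S omega j := zs j omega.
pose Si omega := replace_at (S omega) i (z' omega).
pose eps_stab := (\int[P]_omega
  (norm2 (gd f eta W1 (S omega) T - gd f eta W1 (Si omega) T) ^+ 2)%:E)%E.
pose eps_path := (\sum_(1 <= t < T.+1) (eta t)%:E * \int[P]_omega
  (norm2 (grad (f^~ (zs i omega)) (gd f eta W1 (S omega) t.-1)) ^+ 2)%:E)%E.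
set K := \sum_(1 <= t < T.+1) _.
suff : (eps_stab <= (4 / n%:R ^+ 2)%:E * eps_path * K%:E)%E by [].
pose X (k : option 'I_n) := match k with Some j => zs j | None => z' end.
have distX k : has_distribution P (X k) D by case: k.
(* Both samples are injective selections from the n + 1 independent points: [Some] selects S, and
   [h'] selects S^(i) by taking z_i' at position [i]. *)
pose h' j := if j == i then None else Some j.
have h'_inj : injective h'.
  by move=> j l; rewrite /h'; case: eqP => [->|_]; case: eqP => // _ [].
have Some_inj : injective (@Some 'I_n) by move=> j l [].
pose sample h omega : n.-tuple Z := [tuple X (h j) omega | j < n].
have sampleS omega : tnth (sample Some omega) = S omega.
  by apply/funext => j; rewrite tnth_mktuple.
have sampleSi omega : tnth (sample h' omega) = Si omega.
  by apply/funext => j; rewrite tnth_mktuple /h' /Si /replace_at; case: eqP.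
(* The squared gradient as a function of the sample alone: at S it involves z_i, at S^(i) it
   involves z_i', so exchangeability equates the two expectations. *)
pose phi t (s : n.-tuple Z) : \bar R :=
  (norm2 (grad (f^~ (tnth s i)) (gd f eta W1 (tnth s) t.-1)) ^+ 2)%:E.
have mphi t : measurable_fun setT (phi t).
  apply/measurable_EFinP/measurable_sqr_norm2 => k.
  apply: (measurable_grad_comp _ _ smooth_f mgrad); last exact: measurable_tnth.
  by apply: (measurable_gd _ _ _ _ smooth_f mgrad) => j; exact: measurable_tnth.
have phi0 t s : (0 <= phi t s)%E by rewrite lee_fin sqr_ge0.
have msample h : measurable_fun setT (sample h) by exact: (measurable_subfamily P D X distX).
have measurable_coord h j :
    measurable_fun setT (fun omega => tnth (sample h omega) j).
  exact: measurableT_comp (measurable_tnth j) (msample h).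
have mphi_sample t h : measurable_fun setT (fun omega => phi t (sample h omega)).
  exact: measurableT_comp.
have phi_exch t : (\int[P]_omega phi t (sample h' omega) =
    \int[P]_omega phi t (sample Some omega))%E.
  exact: (ge0_expectation_subfamily P D X indep distX h' Some (phi t)).
have K0 : 0 <= K.
  apply: sumr_ge0 => t _; rewrite mulr_ge0// prodr_ge0// => j _.
  exact: sqr_ge0.
pose c : R := 2 / n%:R ^+ 2 * K.
have c0 : 0 <= c by rewrite mulr_ge0// divr_ge0// sqr_ge0.
have term0 t omega : (0 <= (eta t)%:E *
    (phi t (sample Some omega) + phi t (sample h' omega)))%E.
  by apply: mule_ge0; [rewrite lee_fin | exact: adde_ge0].
have mterm t : measurable_fun setT (fun omega => (eta t)%:E *
    (phi t (sample Some omega) + phi t (sample h' omega)))%E.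
  by apply: measurable_funeM; exact: emeasurable_funD.
have integral_term t : (\int[P]_omega ((eta t)%:E *
      (phi t (sample Some omega) + phi t (sample h' omega))) =
    2%:E * ((eta t)%:E * \int[P]_omega phi t (sample Some omega)))%E.
  rewrite ge0_integralZl_EFin//; first last.
  - exact: emeasurable_funD.
  - by move=> omega _; exact: adde_ge0.
  rewrite (@ge0_integralD _ _ _ P _ measurableT
    (fun omega => phi t (sample Some omega))
    (fun omega => phi t (sample h' omega)))//.
  by rewrite (phi_exch t) -mule2n -mule_natl muleCA.
have stab_le : (eps_stab <=
    \int[P]_omega (c%:E * \sum_(1 <= t < T.+1) (eta t)%:E *
      (phi t (sample Some omega) + phi t (sample h' omega))))%E.
  apply: ge0_le_integral => //.
  - by move=> omega _; rewrite lee_fin sqr_ge0.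
  - apply/measurable_EFinP/measurable_sqr_norm2 => k.
    under eq_fun do rewrite !mxE -sampleS -sampleSi.
    by apply: measurable_funB; apply: (measurable_gd _ _ _ _ smooth_f mgrad) => j;
      exact: measurable_coord.
  - by apply: measurable_funeM; exact: emeasurable_sum.
  - move=> omega _.
    under eq_bigr do rewrite -EFinD -EFinM.
    rewrite sumEFin -EFinM lee_fin.
    under eq_bigr do rewrite sampleS sampleSi /Si /replace_at eqxx.
    exact: gd_replace_stability.
apply: le_trans stab_le _.
rewrite ge0_integralZl_EFin//; first last.
- by apply: emeasurable_sum.
- by move=> omega _; exact: sume_ge0.
rewrite ge0_integral_sum//.
under eq_bigr do rewrite integral_term.
rewrite -ge0_sume_distrr; last first.
  by move=> t _; apply: mule_ge0; [rewrite lee_fin | exact: integral_ge0].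
have -> : (\sum_(1 <= t < T.+1)
    (eta t)%:E * \int[P]_omega phi t (sample Some omega) = eps_path)%E.
  rewrite /eps_path; apply: eq_bigr => t _.
  by under eq_integral do rewrite /phi sampleS.
(* The constant 4 is the 2 in [c], from squaring a sum of two gradient norms, times the 2 from the
   two equal expectations. *)
rewrite muleA -EFinM muleAC -EFinM le_eqVlt; apply/orP; left; apply/eqP.
by congr (_%:E * _)%E; rewrite /c; ring.
Qed.
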